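(* Let $X,Y$ be real Hilbert spaces, let $F:X\to Y$ be Fréchet differentiable, let $y\in Y$ (the true data), and assume: (1) $F$ has a nonnegative minimum norm solution $u^\dagger$ (in particular $F(u^\dagger)=y$) such that there exists a constant $R>0$ with $\Phi(u^\dagger)<R$; (2) $F'$ is Lipschitz continuous with Lipschitz constant $L$; (3) there exists $w\in Y$ such that $u^\dagger=F'(u^\dagger)^*w$ and $L\|w\|_Y<1$. Let $c_1,c_2,c_3,c_4>0$ be constants. Then there exists a constant $c>0$ such that for all $0<\delta<1$, all $y^\delta\in Y$ with $\|y^\delta-y\|_Y\le\delta$, and all $\lambda,\alpha$ satisfying $c_1\sqrt{\delta}<\lambda<c_2\sqrt{\delta}$ and $c_3\delta<\alpha<c_4\delta$, the stability estimate $$\|u^\delta_{\lambda,\alpha}-u^\dagger\|_X\le c\,\delta^{1/4}$$ holds, where $u^\delta_{\lambda,\alpha}$ is the global minimizer over $X$ of the functional $$\Theta(u)=\|F(u)-y^\delta\|_Y^2+\lambda\|u\|_X^2+\alpha\Phi(u).$$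
   Context: Let $\{\varphi_i\}_{i\in\Lambda}$ be a fixed orthonormal basis of $X$ and write $u_i=\langle u,\varphi_i\rangle_X$ for the coefficients of $u\in X$. The functional $\Phi:X\to[0,+\infty]$ is $$\Phi(u)=\begin{cases}\sum_{i\in\Lambda}u_i,&\text{if }u\ge0,\\+\infty,&\text{otherwise},\end{cases}$$ where $u\ge0$ (''nonnegative'') means $u_i\ge0$ for all $i\in\Lambda$. A minimum norm solution $u^\dagger$ is an element of $X$ with $F(u^\dagger)=y$ having minimal $X$-norm among all solutions of $F(u)=y$. $F'(u)^*$ denotes the Hilbert space adjoint of the Fréchet derivative $F'(u):X\to Y$. *)

(* Defs.v *)
From HB Require Import structures.
From mathcomp Require Import all_boot all_order all_algebra.
From mathcomp Require Import all_classical all_reals all_analysis.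
From mathcomp Require Import ring lra.

Set Implicit Arguments.
Unset Strict Implicit.
Unset Printing Implicit Defensive.

Import Order.TTheory GRing.Theory Num.Theory.
Import numFieldNormedType.Exports.

Local Open Scope classical_set_scope.
Local Open Scope ring_scope.

(* A real Hilbert space is a complete normed module whose norm is induced by
   an inner product; [{dot T for idfun}] is the type of symmetric, positive
   definite bilinear forms. *)
HB.mixin Record CompleteNormedModule_isHilbert (R : realType) T
    of CompleteNormedModule R T := {
  inner : {dot T for @idfun R} ;
  inner_normE : forall u : T, inner u u = `|u| ^+ 2
}.

#[short(type="hilbertType")]
HB.structure Definition Hilbert (R : realType) :=
  {T of CompleteNormedModule_isHilbert R T & CompleteNormedModule R T}.

(* Orthonormal with dense linear span; the index set need not be countable. *)
Definition orthonormal_basis (R : realType) (X : hilbertType R)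
    (I : choiceType) (phi : I -> X) : Prop :=
  (forall i j, inner (phi i) (phi j) = (i == j)%:R) /\
  closure [set u | exists (s : seq I) (a : I -> R),
                     u = \sum_(i <- s) a i *: phi i] = setT.

Definition nonnegative (R : realType) (X : hilbertType R)
    (I : choiceType) (phi : I -> X) (u : X) : Prop :=
  forall i, 0 <= inner u (phi i).

(* [\esum] is only meaningful for nonnegative terms, which the test ensures. *)
Definition sum_coef (R : realType) (X : hilbertType R)
    (I : choiceType) (phi : I -> X) (u : X) : \bar R :=
  if `[< nonnegative phi u >]
  then (\esum_(i in [set: I]) (inner u (phi i))%:E)%E
  else +oo%E.

Definition tikhonov (R : realType) (X Y : hilbertType R)
    (I : choiceType) (phi : I -> X) (F : X -> Y) (z : Y) (lambda alpha : R)
    (u : X) : \bar R :=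
  ((`|F u - z| ^+ 2 + lambda * `|u| ^+ 2)%:E + alpha%:E * sum_coef phi u)%E.

Definition global_minimizer (R : realType) (T : Type) (f : T -> \bar R)
    (u : T) : Prop :=
  forall v, (f u <= f v)%E.

Definition min_norm_solution (R : realType) (X Y : normedModType R)
    (F : X -> Y) (y : Y) (u : X) : Prop :=
  F u = y /\ forall v, F v = y -> `|u| <= `|v|.

(* Meaningful for bounded linear f only: [sup] is 0 on unbounded sets. *)
Definition op_norm (R : realType) (X Y : normedModType R) (f : X -> Y) : R :=
  sup [set `|f h| | h in [set h : X | `|h| <= 1]].

(* The Hilbert space adjoint, well defined for continuous linear f: see
   [adjointP] and [adjoint_unique]. *)
Definition adjoint (R : realType) (X Y : hilbertType R) (f : X -> Y) (w : Y)
    : X :=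
  get [set v | forall h, inner (f h) w = inner h v].

Section adjoint_theory.
Context {R : realType}.

Lemma innerC (X : hilbertType R) (u v : X) : inner u v = inner v u.
Proof. by rewrite hermitian_subproof expr0 mul1r. Qed.

Lemma inner_inj (X : hilbertType R) (u v : X) :
  (forall h, inner h u = inner h v) -> u = v.
Proof.
move=> uv; apply/eqP; rewrite -subr_eq0 -normr_eq0 -sqrf_eq0 -inner_normE.
by rewrite linearBr /= uv subrr.
Qed.

Lemma innerDl (X : hilbertType R) (u v w : X) :
  inner (u + v) w = inner u w + inner v w.
Proof. exact: linearDl. Qed.

Lemma innerZl (X : hilbertType R) a (u w : X) : inner (a *: u) w = a * inner u w.
Proof. exact: linearZl_LR. Qed.

Lemma inner0l (X : hilbertType R) (w : X) : inner 0 w = 0.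
Proof. exact: linear0l. Qed.

Lemma innerDr (X : hilbertType R) (u v w : X) :
  inner w (u + v) = inner w u + inner w v.
Proof. exact: linearDr. Qed.

Lemma innerZr (X : hilbertType R) a (u w : X) : inner w (a *: u) = a * inner w u.
Proof. by rewrite innerC innerZl innerC. Qed.

Lemma normDZsqr (X : hilbertType R) (t : R) (u v : X) :
  `|u + t *: v| ^+ 2 = `|u| ^+ 2 + 2 * t * inner u v + t ^+ 2 * `|v| ^+ 2.
Proof.
rewrite -!inner_normE !(innerDl, innerDr) !(innerZl, innerZr) (innerC v u).
by ring.
Qed.

Lemma inner_le (X : hilbertType R) (u v : X) : `|inner u v| <= `|u| * `|v|.
Proof.
have [->|v0] := eqVneq v 0; first by rewrite innerC inner0l !normr0 mulr0.
have nv : 0 < `|v| by rewrite normr_gt0.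
rewrite -ler_sqr ?nnegrE ?mulr_ge0// exprMn -normrX ger0_norm ?sqr_ge0//.
have := sqr_ge0 `|u + (- inner u v / `|v| ^+ 2) *: v|.
rewrite normDZsqr => h.
have {h} : 0 <= `|u| ^+ 2 - inner u v ^+ 2 / `|v| ^+ 2.
  by apply: le_trans h _; rewrite le_eqVlt; apply/orP; left; apply/eqP; field; rewrite gt_eqF.
by rewrite subr_ge0 ler_pdivrMr// exprn_gt0.
Qed.

Lemma riesz (X : hilbertType R) (f : X -> R) (M : R) :
    (forall a u v, f (a *: u + v) = a * f u + f v) ->
    (forall h, `|f h| <= M * `|h|) ->
  exists v, forall h, f h = inner h v.
Proof.
move=> flin fM.
have fDZ t u v : f (u + t *: v) = f u + t * f v by rewrite addrC flin addrC.
have f0 : f 0 = 0.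
  by have := fM 0; rewrite normr0 mulr0 normr_le0 => /eqP.
have fZ t u : f (t *: u) = t * f u by rewrite -[t *: u]addr0 flin f0 addr0.
pose q x : R := `|x| ^+ 2 / 2 - f x.
have qlb : has_inf (range q).
  split; first by exists (q 0), 0.
  exists (- M ^+ 2 / 2) => _ [x _ <-]; rewrite /q.
  have := fM x; rewrite ler_norml => /andP[_ ?].
  by have := sqr_ge0 (`|x| - M); nra.
have qm x : inf (range q) <= q x by apply: ge_inf; [case: qlb | exists x].
have /choice[x xq] : forall n : nat, exists x, q x < inf (range q) + n.+1%:R^-1.
  move=> n; have /(inf_adherent)/(_ qlb)[_ [x _ <-] ?] : 0 < n.+1%:R^-1 :> R.
    by rewrite invr_gt0.
  by exists x.
have xdist u v e : q u < inf (range q) + e -> q v < inf (range q) + e ->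
    `|u - v| ^+ 2 < 8 * e.
  move=> ue ve; have := qm (2^-1 *: (u + 1 *: v)).
  rewrite /q fZ fDZ normrZ exprMn normDZsqr normfV ger0_norm//.
  have -> : u - v = u + (-1) *: v by rewrite scaleN1r.
  rewrite normDZsqr.
  by move: ue ve; rewrite /q; lra.
have /cvg_ex[/= z xz] : cvg (x @ \oo).
  apply/cauchy_cvgP/cauchy_exP => e e0.
  have [N _ Ne] : \forall n \near \oo, n.+1%:R^-1 < e ^+ 2 / 8 :> R.
    by apply: (near_infty_natSinv_lt (PosNum _)); rewrite divr_gt0 ?exprn_gt0.
  exists (x N); exists N => // n /= Nn; rewrite -ball_normE /=.
  rewrite -ltr_sqr ?nnegrE ?(ltW e0)//.
  have -> : e ^+ 2 = 8 * (e ^+ 2 / 8) by field.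
  by apply: xdist; apply: lt_trans (xq _) _; rewrite ltrD2l; apply: Ne => /=.
exists z => h; rewrite innerC.
set d := inner z h - f h.
suff : d = 0 by move=> /eqP; rewrite subr_eq0 => /eqP.
have dt t : 0 <= t * d + t ^+ 2 * `|h| ^+ 2 / 2.
  apply/ler_addgt0Pr => e e0.
  pose k : R := `|t| * `|h| + 1.
  have k0 : 0 < k by rewrite ltr_wpDl ?mulr_ge0.
  have /cvgrPdist_lt /(_ (e / (2 * k))) xz' := xz.
  have /filterI/(_ (near_infty_natSinv_lt (PosNum (divr_gt0 e0 (ltr0Sn R 1))))) :=
    xz' (divr_gt0 e0 (mulr_gt0 (ltr0Sn R 1) k0)).
  case=> N _ /(_ N (leqnn N))[/= zN Ne].
  have := lt_le_trans (xq N) (lerD (qm (x N + t *: h)) (lexx _)).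
  rewrite /q fDZ normDZsqr => qN.
  have : t * inner (x N) h <= t * inner z h + `|t| * `|h| * (e / (2 * k)).
    rewrite -lerBlDl -mulrBr.
    have <- : inner (x N - z) h = inner (x N) h - inner z h by exact: linearBl.
    apply: le_trans (ler_norm _) _; rewrite normrM -mulrA ler_wpM2l//.
    apply: le_trans (inner_le _ _) _; rewrite mulrC ler_wpM2l// distrC.
    exact: ltW.
  have : `|t| * `|h| * (e / (2 * k)) <= e / 2.
    have -> : e / 2 = k * (e / (2 * k)) by field; rewrite gt_eqF.
    by rewrite ler_wpM2r ?lerDl// divr_ge0 ?mulr_ge0 ?ltW.
  move: qN Ne; rewrite /d.
  move: (e / (2 * k)) (inner _ _) (inner _ _) (`|x N| ^+ 2) (`|h| ^+ 2) N.+1%:R^-1.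
  by move=> *; lra.
have H1 : 0 < `|h| ^+ 2 + 1 by rewrite ltr_pwDr ?sqr_ge0.
have := dt (- d / (`|h| ^+ 2 + 1)); set H := `|h| ^+ 2 in H1 *.
have -> : - d / (H + 1) * d + (- d / (H + 1)) ^+ 2 * H / 2 =
   - (d ^+ 2 * ((H + 2) / (2 * (H + 1) ^+ 2))).
  by field; rewrite gt_eqF.
rewrite oppr_ge0 pmulr_lle0; last first.
  by rewrite divr_gt0 ?mulr_gt0 ?exprn_gt0//; lra.
by move=> d0; apply/eqP; rewrite -sqrf_eq0 eq_le d0 sqr_ge0.
Qed.

Lemma adjointP (X Y : hilbertType R) (f : {linear X -> Y}) :
  continuous f -> forall h w, inner (f h) w = inner h (adjoint f w).
Proof.
move=> /(_ 0) /continuous_linear_bounded /linear_boundedP [M [_ fM]] h w.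
have M1 : M < M + 1 by rewrite ltrDl.
have [v fv] : exists v, forall h, inner (f h) w = inner h v.
  apply: (@riesz _ (fun h => inner (f h) w) ((M + 1) * `|w|)) => [a u v|k].
    by rewrite linearP linearPl.
  apply: le_trans (inner_le _ _) _; rewrite mulrAC ler_wpM2r//; exact: fM.
exact: (@getPex _ [set v | forall h, inner (f h) w = inner h v]
  (ex_intro _ v fv)).
Qed.

Lemma adjoint_unique (X Y : hilbertType R) (f : X -> Y) (g : Y -> X) :
  (forall h w, inner (f h) w = inner h (g w)) -> adjoint f = g.
Proof.
move=> fg; apply/funext => w; apply: inner_inj => h; rewrite -fg.
have fgw : exists v, forall h, inner (f h) w = inner h v by exists (g w).
by have /(_ h) -> := getPex (P := [set v | _]) fgw.
Qed.

End adjoint_theory.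

(* Main.v *)
(* Comparing Theta at its minimizer u and at udag, the source condition
   udag = F'(udag)^* w turns the cross term <udag, u - udag> into
   <w, F'(udag)(u - udag)>, which is |w| (|F u - y^delta| + delta) up to the
   second-order Taylor remainder L/2 |w| |u - udag|^2. As L |w| < 1 the
   remainder is absorbed by lambda |u - udag|^2; the discrepancy is absorbed by
   completing the square. What is left is
   lambda (1 - L |w|) |u - udag|^2 <=
     delta^2 + alpha r + 2 lambda |w| delta + lambda^2 |w|^2 = O(delta). *)
Require Import Defs.
From mathcomp Require Import all_boot all_order all_algebra.
From mathcomp Require Import all_classical all_reals all_analysis.
From mathcomp Require Import ring lra.

Set Implicit Arguments.
Unset Strict Implicit.

Import Order.TTheory GRing.Theory Num.Theory.
Import numFieldNormedType.Exports.

Local Open Scope classical_set_scope.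
Local Open Scope ring_scope.

(** Continuity bounds the set under [sup], so [op_norm f] is a true supremum and not the default 0;
    rescaling [h] to norm 1 then gives the bound. *)
Lemma op_norm_ler (R : realType) (X Y : normedModType R) (f : {linear X -> Y})
    (h : X) :
  continuous f -> `|f h| <= op_norm f * `|h|.
Proof.
move=> /(_ 0) /continuous_linear_bounded /linear_boundedP [M [_ fM]].
have [->|h0] := eqVneq h 0; first by rewrite linear0 !normr0 mulr0.
have nh : 0 < `|h| by rewrite normr_gt0.
rewrite -ler_pdivrMr// mulrC.
have <- : `|f (`|h|^-1 *: h)| = `|h|^-1 * `|f h|.
  by rewrite linearZ normrZ gtr0_norm// invr_gt0.
apply: ub_le_sup => /=; last first.
  by exists (`|h|^-1 *: h) => //=; rewrite normrZ gtr0_norm ?invr_gt0// mulVf ?gt_eqF.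
(* [M] may be negative; the maximum with 0 makes the bound nonnegative, so that multiplying it by a
   norm at most 1 does not increase it. *)
have M1 : Num.max M 0 < Num.max M 0 + 1 by rewrite ltrDl.
exists (Num.max M 0 + 1) => _ [k /= k1 <-].
have MM : M < Num.max M 0 + 1 by apply: le_lt_trans M1; rewrite le_max lexx.
apply: le_trans (fM _ MM k) _.
by rewrite ler_piMr// addr_ge0// le_max lexx orbT.
Qed.

Lemma cvg_inner (R : realType) (Y : hilbertType R) (T : Type)
    (G : set_system T) (FG : Filter G) (f : T -> Y) (l w : Y) :
  f x @[x --> G] --> l -> inner (f x) w @[x --> G] --> inner l w.
Proof.
move=> fl; apply/cvgrPdist_lt => e e0.
(* Adding 1 keeps the divisor positive when [w] is 0. *)
have w1 : 0 < `|w| + 1 by rewrite ltr_wpDl.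
move/cvgrPdist_lt: fl => /(_ _ (divr_gt0 e0 w1)).
apply: filterS => x xe; rewrite -[X in `|X|]linearBl.
apply: le_lt_trans (inner_le _ _) _.
apply: (@le_lt_trans _ _ (`|l - f x| * (`|w| + 1))).
  by rewrite ler_wpM2l// lerDl.
by rewrite -ltr_pdivlMr.
Qed.

Lemma is_derive_inner (R : realType) (V : normedModType R) (Y : hilbertType R)
    (f : V -> Y) (a v : V) (df w : Y) :
  is_derive a v f df -> is_derive a v (fun x => inner (f x) w) (inner df w).
Proof.
move=> [fd <-].
have q : inner (h^-1 *: ((f \o shift a) (h *: v) - f a)) w @[h --> 0^']
    --> inner ('D_v f a) w by apply: cvg_inner; exact: fd.
have E : (fun h : R => inner (h^-1 *: ((f \o shift a) (h *: v) - f a)) w) =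
    (fun h => h^-1 *: (((fun x => inner (f x) w) \o shift a) (h *: v) -
                       inner (f a) w)).
  by apply/funext => h; rewrite innerZl -[in RHS]linearBl.
rewrite E in q; split; first by apply/cvg_ex; exists (inner ('D_v f a) w).
exact: cvg_lim q.
Qed.

(** As functions of the increment, the difference quotient of the restriction at [t] and that of [F]
    at [x + t *: d] along [d] coincide, so no chain rule is needed. *)
Lemma is_derive_segment (R : realType) (X Y : normedModType R) (F : X -> Y)
    (x d : X) (t : R) :
  differentiable F (x + t *: d) ->
  is_derive t 1 (fun s : R => F (x + s *: d)) ('d F (x + t *: d) d).
Proof.
move=> hF; rewrite -deriveE//; have Fd := diff_derivable (v := d) hF.
have E : (fun h : R => h^-1 *: ((F \o shift (x + t *: d)) (h *: d) -
                                F (x + t *: d))) =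
    (fun h : R => h^-1 *: (((fun s : R => F (x + s *: d)) \o shift t) (h *: 1) -
                       F (x + t *: d))).
  apply/funext => h /=; congr (_ *: (F _ - _)).
  by rewrite [h *: 1]mulr1 scalerDl addrCA.
by split; rewrite /derivable /derive -E.
Qed.

(** Pairing with [w] reduces the remainder to a real function on [0, 1], avoiding a vector-valued
    integral: [g] is the paired [F] minus its linear part and [k * t ^ 2], the Lipschitz bound makes
    its derivative nonpositive, and [g 1 <= g 0] is the claim. *)
Lemma taylor_inner (R : realType) (X Y : hilbertType R) (F : X -> Y)
    (hF : forall u : X, differentiable F u) (L : R)
    (hL : forall u v : X,
      op_norm (fun h => 'd F u h - 'd F v h) <= L * `|u - v|)
    (x d : X) (w : Y) :
  inner (F (x + d) - F x - 'd F x d) w <= L / 2 * `|d| ^+ 2 * `|w|.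
Proof.
pose k := L / 2 * `|d| ^+ 2 * `|w|.
pose g : R -> R := (fun t => inner (F (x + t *: d)) w)
  - (inner ('d F x d) w *: id + k *: id ^+ 2).
have dg (t : R) : is_derive t 1 g (inner ('d F (x + t *: d) d) w
    - (inner ('d F x d) w *: 1 + k *: ((2%:R * t ^+ 1) *: 1))).
  by apply: is_deriveB; apply: is_derive_inner; exact: is_derive_segment.
have g_nincr : g 1 <= g 0.
  apply: (@ler0_derive1_nincr _ g 0 1) => //.
  - move=> t; rewrite in_itv /= => /andP[t0 _].
    rewrite derive1E (@derive_val _ _ _ _ _ _ _ (dg t)).
    (* The slope [2 * k * t] is exactly the Lipschitz bound between [x + t *: d] and [x], applied to
       [d] and paired with [w]. *)
    have -> : k *: ((2%:R * t ^+ 1) *: 1) = L * (t * `|d|) * `|d| * `|w|.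
      by rewrite /k /GRing.scale /=; field.
    rewrite [_ *: 1]mulr1 opprD addrA.
    have <- : inner ('d F (x + t *: d) d - 'd F x d) w =
      inner ('d F (x + t *: d) d) w - inner ('d F x d) w by exact: linearBl.
    rewrite subr_le0; apply: le_trans (ler_norm _) _.
    apply: le_trans (inner_le _ _) _; rewrite ler_wpM2r//.
    apply: le_trans (@op_norm_ler _ _ _ ('d F (x + t *: d) \- 'd F x) d _) _.
      by move=> z; apply: cvgB; exact: diff_continuous.
    rewrite ler_wpM2r//; apply: le_trans (hL _ _) _.
    by rewrite addrAC subrr add0r normrZ gtr0_norm.
  - apply: derivable_within_continuous => t _; exact: ex_derive.
move: g_nincr; rewrite /g !fctE /= scale1r scale0r addr0.
rewrite -[k]/(L / 2 * `|d| ^+ 2 * `|w|).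
rewrite !linearBl /= /GRing.scale /= expr0n expr1n /=; lra.
Qed.

Lemma sum_coef_ge0 (R : realType) (X : hilbertType R) (I : choiceType)
    (phi : I -> X) (u : X) :
  (0 <= sum_coef phi u)%E.
Proof.
rewrite /sum_coef; case: asboolP => [u0|_]; last exact: leey.
by apply: esum_ge0 => i _; rewrite lee_fin.
Qed.

(** The penalty at [u] is nonnegative and is dropped, the one at [v] is finite and below [r]; this
    moves the comparison from extended reals to reals. *)
Lemma tikhonov_min_le (R : realType) (X Y : hilbertType R) (I : choiceType)
    (phi : I -> X) (F : X -> Y) (z : Y) (lambda alpha r : R) (u v : X) :
  0 <= alpha -> (sum_coef phi v < r%:E)%E ->
  global_minimizer (tikhonov phi F z lambda alpha) u ->
  `|F u - z| ^+ 2 + lambda * `|u| ^+ 2 <=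
  `|F v - z| ^+ 2 + lambda * `|v| ^+ 2 + alpha * r.
Proof.
move=> a0 vr /(_ v); rewrite /tikhonov => uv.
rewrite -lee_fin EFinD [leRHS]EFinD -EFinD -[leLHS]adde0.
apply: le_trans (leeD (lexx _) _) (le_trans uv (leeD (lexx _) _)).
  by rewrite mule_ge0// ?lee_fin// sum_coef_ge0.
by rewrite EFinM lee_wpmul2l ?lee_fin// ltW.
Qed.

Lemma source_condition_estimate (R : realType) (X Y : hilbertType R)
    (I : choiceType) (phi : I -> X) (F : X -> Y)
    (hF : forall u : X, differentiable F u) (udag : X) (r : R)
    (hPhi : (sum_coef phi udag < r%:E)%E) (L : R)
    (hL : forall u v : X,
      op_norm (fun h => 'd F u h - 'd F v h) <= L * `|u - v|)
    (w : Y) (hw : udag = adjoint ('d F udag) w)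
    (delta lambda alpha : R) (z : Y) (u : X) :
  0 <= lambda -> 0 <= alpha -> `|F udag - z| <= delta ->
  global_minimizer (tikhonov phi F z lambda alpha) u ->
  lambda * (1 - L * `|w|) * `|u - udag| ^+ 2 <=
  delta ^+ 2 + alpha * r + 2 * lambda * `|w| * delta + lambda ^+ 2 * `|w| ^+ 2.
Proof.
move=> l0 a0 zd umin; have := tikhonov_min_le a0 hPhi umin.
set d := u - udag; have ud : u = udag + 1 *: d.
  by rewrite scale1r /d addrC subrK.
rewrite [`|u| ^+ 2](_ : _ = `|udag| ^+ 2 + 2 * inner udag d + `|d| ^+ 2); last first.
  by rewrite {1}ud normDZsqr expr1n mulr1 mul1r.
(* The source condition enters here; differentiability supplies the continuity under which [adjoint]
   is a genuine adjoint. *)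
have -> : inner udag d = inner ('d F udag d) w.
  by rewrite innerC {1}hw adjointP//; exact: diff_continuous.
have := taylor_inner hF hL udag d w.
have -> : udag + d = u by rewrite [RHS]ud scale1r.
have -> : inner (F u - F udag - 'd F udag d) w =
    inner (F u - F udag) w - inner ('d F udag d) w by exact: linearBl.
have : - inner (F u - F udag) w <= (`|F u - z| + delta) * `|w|.
  apply: le_trans (ler_norm _) _; rewrite normrN.
  apply: le_trans (inner_le _ _) _; rewrite ler_wpM2r//.
  rewrite -(subrKA z); apply: le_trans (ler_normD _ _) _.
  by rewrite lerD2l distrC.
have : `|F udag - z| ^+ 2 <= delta ^+ 2 by rewrite ler_sqr ?nnegrE ?(le_trans _ zd).
move: (inner (F u - F udag) w) (inner ('d F udag d) w) `|F u - z|.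
move=> A B a dz h1 h2 h3.
(* Adding [h1] and [h2] eliminates [A]. The factor 2 of the cross term will turn [L / 2] into [L],
   hence the coefficient [1 - L * |w|]. *)
have {h1 h2} : lambda * (- B) <=
    lambda * ((a + delta) * `|w| + L / 2 * `|d| ^+ 2 * `|w|).
  by rewrite ler_wpM2l//; lra.
by have := sqr_ge0 (a - lambda * `|w|); lra.
Qed.

Theorem proposition6 (R : realType) (X Y : hilbertType R)
    (I : choiceType) (phi : I -> X) (hphi : orthonormal_basis phi)
    (F : X -> Y) (hF : forall u : X, differentiable F u)
    (y : Y) (udag : X)
    (hsol : min_norm_solution F y udag) (hnneg : nonnegative phi udag)
    (r : R) (hr : 0 < r) (hPhi : (sum_coef phi udag < r%:E)%E)
    (L : R)
    (hL : forall u v : X, op_norm (fun h => 'd F u h - 'd F v h) <= L * `|u - v|)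
    (w : Y) (hw : udag = adjoint ('d F udag) w) (hLw : L * `|w| < 1)
    (c1 c2 c3 c4 : R)
    (hc1 : 0 < c1) (hc2 : 0 < c2) (hc3 : 0 < c3) (hc4 : 0 < c4) :
  exists2 c : R, 0 < c &
    forall delta : R, 0 < delta < 1 ->
    forall ydelta : Y, `|ydelta - y| <= delta ->
    forall lambda alpha : R,
      c1 * Num.sqrt delta < lambda < c2 * Num.sqrt delta ->
      c3 * delta < alpha < c4 * delta ->
    forall u : X, global_minimizer (tikhonov phi F ydelta lambda alpha) u ->
      `|u - udag| <= c * delta `^ (4^-1).
Proof.
(* [K * delta] bounds the right-hand side of the estimate, term by term, using [delta < 1] and the
   upper bounds on [alpha] and [lambda]. *)
pose K := 1 + c4 * r + 2 * c2 * `|w| + c2 ^+ 2 * `|w| ^+ 2.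
have K0 : 0 < K.
  by rewrite /K -!addrA ltr_pwDl// !addr_ge0// !mulr_ge0// ?sqr_ge0// ltW.
have Lw : 0 < 1 - L * `|w| by rewrite subr_gt0.
have C0 : 0 < K / (c1 * (1 - L * `|w|)) by rewrite !(mulr_gt0, invr_gt0).
(* Dividing [K * delta] by the lower bound [c1 * sqrt delta] of [lambda] leaves order [sqrt delta]
   for the squared error; the square root gives the rate 1/4. *)
exists (Num.sqrt (K / (c1 * (1 - L * `|w|)))); first by rewrite sqrtr_gt0.
move=> delta /andP[d0 d1] z zd lambda alpha /andP[l1 l2] /andP[a1 a2] u umin.
have [Fudag _] := hsol.
have l0 : 0 <= lambda by apply: ltW; apply: le_lt_trans l1; rewrite mulr_ge0 ?sqrtr_ge0 ?ltW.
have a0 : 0 <= alpha by apply: ltW; apply: le_lt_trans a1; rewrite mulr_ge0 ?ltW.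
have dz : `|F udag - z| <= delta by rewrite Fudag distrC.
have est := source_condition_estimate hF hPhi hL hw l0 a0 dz umin.
have q2 : (delta `^ 4^-1) ^+ 2 = Num.sqrt delta.
  rewrite -powR_mulrn ?powR_ge0// -powRrM -powR12_sqrt ?ltW//; congr (_ `^ _).
  by field.
have s2 : delta = Num.sqrt delta ^+ 2 by rewrite sqr_sqrtr ?ltW.
rewrite -ler_sqr ?nnegrE ?mulr_ge0 ?sqrtr_ge0 ?powR_ge0 // exprMn q2.
rewrite (sqr_sqrtr (ltW C0)) mulrAC ler_pdivlMr ?mulr_gt0//.
have s0 : 0 < Num.sqrt delta by rewrite sqrtr_gt0.
move: (Num.sqrt delta) s0 s2 l1 l2 => s s0 s2 l1 l2.
(* The extra factor [s] makes [c1 * s] appear on the left, to be compared with [lambda], and turns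
   the right side into [K * delta]. *)
rewrite -(ler_pM2r s0).
have lb : c1 * s * ((1 - L * `|w|) * `|u - udag| ^+ 2) <=
    lambda * ((1 - L * `|w|) * `|u - udag| ^+ 2).
  by rewrite ler_wpM2r ?(ltW l1)// mulr_ge0 ?sqr_ge0 ?(ltW Lw).
have e1 : delta ^+ 2 <= delta by rewrite expr2 ler_piMl// ltW.
have e2 : alpha * r <= c4 * delta * r by rewrite ler_wpM2r// ltW.
(* The cross term already carries a factor [delta], so this cruder bound, from [sqrt delta <= 1],
   suffices there. *)
have l3 : lambda <= c2.
  apply: ltW; apply: lt_le_trans l2 _; rewrite ler_piMr ?ltW//.
  by rewrite -(@ltr_pXn2r _ 2) ?nnegrE ?ltW// expr1n -s2.
have e3 : lambda * (`|w| * delta) <= c2 * (`|w| * delta).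
  by rewrite ler_wpM2r// mulr_ge0// ltW.
have e4 : lambda ^+ 2 * `|w| ^+ 2 <= (c2 * s) ^+ 2 * `|w| ^+ 2.
  by rewrite ler_wpM2r ?sqr_ge0// ler_sqr ?nnegrE// ltW// mulr_gt0.
have -> : K * s * s = delta + c4 * delta * r + 2 * (c2 * (`|w| * delta)) +
    (c2 * s) ^+ 2 * `|w| ^+ 2.
  by rewrite /K s2; ring.
by move: est lb e1 e2 e3 e4; lra.
Qed.
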